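(* Let $G\rightrightarrows M$ be a Lie groupoid with anchor $\rho=(t,s):G\to M\times M$, and let $g\in G$ be an arrow with source $x$ and target $y$. Let $\eta_g:N_xO\to N_yO$ be the normal representation along the orbit $O$ of $x$. Then the differential $d_g\rho:T_gG\to T_yM\times T_xM$ has kernel and image given by $$\ker(d_g\rho)=T_gG(y,x),\qquad \operatorname{im}(d_g\rho)=\{(v,w)\in T_yM\times T_xM : [v]=\eta_g[w]\},$$ where $[v]\in N_yO$ and $[w]\in N_xO$ denote the classes of $v$ and $w$.
   Context: Manifolds are smooth, Hausdorff, second countable and without boundary. A Lie groupoid $G\rightrightarrows M$ consists of a manifold $M$ of objects, a manifold $G$ of arrows, surjective submersions $s,t:G\to M$ (source and target), and smooth associative multiplication, unit and inverse maps; arrows are written from right to left, $y\xleftarrow{g}x$ meaning $s(g)=x$, $t(g)=y$. The set $G(y,x)=\{g\in G: s(g)=x,\ t(g)=y\}$ is an embedded submanifold of $G$. The orbit of $x$ is $O=t(s^{-1}(x))\subset M$, an (immersed) submanifold of $M$ with the structure coming from the identification $O\cong s^{-1}(x)/G_x$, where $G_x=G(x,x)$ is the isotropy Lie group. $NO=TM|_O/TO$ is its normal bundle. The normal representation assigns to $y\xleftarrow{g}x$ with $x,y\in O$ the linear isomorphism $\eta_g:N_xO\to N_yO$ defined by $\eta_g[w]=[d_gt(\xi)]$, where $\xi\in T_gG$ is any vector with $d_gs(\xi)=w$ (this is well defined). *)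

(* Defs.v *)
From HB Require Import structures.
From mathcomp Require Import all_boot all_order all_algebra ring_quotient.
From mathcomp Require Import all_classical all_reals all_analysis.

Set Implicit Arguments.
Unset Strict Implicit.
Unset Printing Implicit Defensive.

Import Order.TTheory GRing.Theory Num.Theory.
Import numFieldNormedType.Exports.

Local Open Scope classical_set_scope.
Local Open Scope ring_scope.
Local Open Scope quotient_scope.

Fixpoint Ck_on (R : realType) (V W : normedModType R) (U : set V) (k : nat)
    (f : V -> W) : Prop :=
  if k is k'.+1 then
    (forall u, U u -> differentiable f u) /\ (forall v, Ck_on U k' ('D_v f))
  else forall u, U u -> {for u, continuous f}.

Definition smooth_on (R : realType) (V W : normedModType R) (U : set V)
  (f : V -> W) : Prop := forall k, Ck_on U k f.

(* [cinv] is total for convenience; only its values on the open set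
   [cmap @` cdom] matter. *)
Record chart (R : realType) (T : topologicalType) (n : nat) := Chart {
  cdom : set T;
  cmap : T -> 'rV[R]_n;
  cinv : 'rV[R]_n -> T;
  cdom_open : open cdom;
  cimg_open : open (cmap @` cdom);
  cmapK : forall p, cdom p -> cinv (cmap p) = p;
  cmap_continuous : forall p, cdom p -> {for p, continuous cmap};
  cinv_continuous : forall u, (cmap @` cdom) u -> {for u, continuous cinv} }.

Definition smooth_transition (R : realType) (T : topologicalType) (n : nat)
    (a b : chart R T n) : Prop :=
  smooth_on (cmap a @` (cdom a `&` cdom b)) (cmap b \o cinv a).

(* The smooth structure is given by an atlas indexed by the points of the
   manifold, [chart_at p] being a chart around [p]; every smooth structure is
   generated by such an atlas.  The dimension 0 is allowed, and so is the empty
   manifold. *)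
Record manifold (R : realType) := Manifold {
  mtop :> topologicalType;
  mdim : nat;
  chart_at : mtop -> chart R mtop mdim;
  mtop_hausdorff : hausdorff_space mtop;
  mtop_second_countable : @second_countable mtop;
  chart_at_dom : forall p, cdom (chart_at p) p;
  chart_at_compat : forall p q, smooth_transition (chart_at p) (chart_at q) }.

(* The tangent space at [p], written in the coordinates of [chart_at p]. *)
Definition tangent (R : realType) (M : manifold R) (p : M) : vectType R :=
  'rV[R]_(mdim M).

Section Maps.
Variables (R : realType) (M N : manifold R).
Implicit Types (f : M -> N) (p : M) (q : N).

Definition local_rep f p q : 'rV[R]_(mdim M) -> 'rV[R]_(mdim N) :=
  cmap (chart_at q) \o f \o cinv (chart_at p).

Definition smooth f : Prop :=
  continuous f /\
  forall p q, smooth_on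
    (cmap (chart_at p) @` (cdom (chart_at p) `&` f @^-1` cdom (chart_at q)))
    (local_rep f p q).

Definition mdiff f p : 'Hom(tangent p, tangent (f p)) :=
  linfun ('d (local_rep f p (f p)) (cmap (chart_at p) p)).

Definition immersion f : Prop :=
  smooth f /\ forall p, lker (mdiff f p) = 0%VS.

Definition submersion f : Prop :=
  smooth f /\ forall p, limg (mdiff f p) = fullv.

End Maps.

Section Product.
Variable R : realType.

Lemma row_mx_continuous (m n : nat) :
  continuous (fun ab : 'rV[R]_m * 'rV[R]_n => row_mx ab.1 ab.2).
Proof.
move=> ab A [P Pnbhs PA].
pose f (ij : 'I_1 * 'I_(m + n)) (x : 'rV[R]_m * 'rV[R]_n) : Prop :=
  P ij.1 ij.2 (row_mx x.1 x.2 ij.1 ij.2).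
suff : \forall x \near ab, forall ij, f ij x.
  by apply: filterS => x Px; apply: PA => i j; exact: (Px (i, j)).
apply: (@filter_forall _ _ f _ (nbhs_filter ab)) => -[i j]; have := Pnbhs i j; rewrite mxE.
rewrite (_ : f (i, j) = fun x => P i j (match fintype.split j with
                  | inl k => x.1 i k | inr k => x.2 i k end)); last first.
  by apply/funext => x; rewrite /f mxE.
case: (fintype.split j) => k Pk.
- have c : (fun x : 'rV[R]_m * 'rV[R]_n => x.1 i k) @ ab --> ab.1 i k.
    apply: (@continuous_comp _ _ _ fst (fun M : 'rV[R]_m => M i k)).
      exact: cvg_fst.
    exact: coord_continuous.
  exact: c Pk.
- have c : (fun x : 'rV[R]_m * 'rV[R]_n => x.2 i k) @ ab --> ab.2 i k.
    apply: (@continuous_comp _ _ _ snd (fun M : 'rV[R]_n => M i k)).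
      exact: cvg_snd.
    exact: coord_continuous.
  exact: c Pk.
Qed.

Lemma pair_continuous (T U V : topologicalType) (f : T -> U) (g : T -> V) x :
  {for x, continuous f} -> {for x, continuous g} ->
  {for x, continuous (fun x => (f x, g x))}.
Proof. by move=> cf cg; exact: (cvg_pair cf cg). Qed.

Lemma row_mx_continuous2 (T : topologicalType) m n (f : T -> 'rV[R]_m)
    (g : T -> 'rV[R]_n) x :
  {for x, continuous f} -> {for x, continuous g} ->
  {for x, continuous (fun x => row_mx (f x) (g x))}.
Proof.
move=> cf cg; apply: (@continuous_comp _ _ _ (fun x => (f x, g x))
  (fun ab : 'rV[R]_m * 'rV[R]_n => row_mx ab.1 ab.2)).
  exact: pair_continuous.
exact: row_mx_continuous.
Qed.

Lemma hausdorff_prod (S T : topologicalType) :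
  hausdorff_space S -> hausdorff_space T -> hausdorff_space (S * T)%type.
Proof.
move=> hS hT [a b] [c d] H; congr pair.
- apply: hS => A B nA nB; have [||[x y] [/= Ax Bx]] := H (A `*` setT) (B `*` setT).
  + by exists (A, setT) => //; split => //; exact: filterT.
  + by exists (B, setT) => //; split => //; exact: filterT.
  by exists x; split; [case: Ax | case: Bx].
- apply: hT => A B nA nB; have [||[x y] [/= Ax Bx]] := H (setT `*` A) (setT `*` B).
  + by exists (setT, A) => //; split => //; exact: filterT.
  + by exists (setT, B) => //; split => //; exact: filterT.
  by exists y; split; [case: Ax | case: Bx].
Qed.

Lemma open_prod (S T : topologicalType) (A : set S) (B : set T) :
  open A -> open B -> open (A `*` B).
Proof.
move=> oA oB; rewrite openE => -[a b] [/= Aa Bb].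
by exists (A, B) => //; split; apply: open_nbhs_nbhs.
Qed.

Lemma second_countable_prod (S T : topologicalType) :
  @second_countable S -> @second_countable T ->
  @second_countable (S * T)%type.
Proof.
move=> [B cB [oB bB]] [C cC [oC bC]].
exists ((fun AB : set S * set T => AB.1 `*` AB.2) @` (B `*` C)).
  by apply: (sub_countable (card_image_le _ _)); exact: countableX.
split=> [_ [[U V] [/= BU CV] <-]|[a b] W [[U V] /= [nU nV] UVW]].
  by apply: open_prod; [exact: oB|exact: oC].
have [U' [BU' U'a] U'U] := bB a U nU; have [V' [CV' V'b] V'V] := bC b V nV.
exists (U' `*` V') => /=; first by split => //; exists (U', V').
by move=> [x y] [/= /U'U Ux /V'V Vy]; exact: UVW.
Qed.

Lemma near_eq_differentiable (V W : normedModType R) (f g : V -> W) (a : V) :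
  (\near a, f a = g a) -> differentiable f a -> differentiable g a.
Proof.
move=> fg df; rewrite (_ : g = f \+ (g \- f)); last first.
  by apply/funext => x /=; rewrite addrC subrK.
apply: differentiableD => //.
have h0 : (g \- f) \o shift a = cst ((g \- f) a) + \0 +o_ 0 id.
  apply/eqaddoP => _/posnumP[e].
  have /= fa := nbhs_singleton fg.
  have : \forall x \near 0, f (x + a) = g (x + a).
    by move: fg; rewrite (near_shift 0) /= subr0.
  apply: filterS => x fgx.
  rewrite -![(_ - _) x]/(_ x - _ x) -![(_ + _) x]/(_ x + _ x) /= fgx fa.
  by rewrite !subrr addr0 subrr normr0 mulr_ge0.
have c0 : continuous (\0 : V -> W) by exact: cst_continuous.
apply/diff_locallyP; rewrite (@diff_unique _ _ _ _ (\0 : {linear V -> W})) //.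
Qed.

Lemma Ck_on_ext (V W : normedModType R) (U : set V) k (f g : V -> W) :
  open U -> (forall u, U u -> f u = g u) -> Ck_on U k f -> Ck_on U k g.
Proof.
move=> oU; have fgn (f' g' : V -> W) : (forall u, U u -> f' u = g' u) ->
    forall u, U u -> \near u, f' u = g' u.
  move=> fg u Uu; have : nbhs u U by apply: open_nbhs_nbhs.
  by apply: filterS => x /fg.
elim: k f g => [|k IHk] f g fg /=.
  move=> cf u Uu; have := cf u Uu; rewrite /prop_for /continuous_at (fg u Uu).
  by apply: cvg_trans; apply: near_eq_cvg; exact: fgn.
move=> [df Df]; split=> [u Uu|v].
  by apply: near_eq_differentiable (df u Uu); exact: fgn.
by apply: IHk (Df v) => u Uu; apply: near_eq_derive; exact: fgn.
Qed.


Lemma differentiable_row_mx (V : normedModType R) m n (f : V -> 'rV[R]_m)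
    (g : V -> 'rV[R]_n) (u : V) :
  differentiable f u -> differentiable g u ->
  differentiable (fun x => row_mx (f x) (g x)) u /\
  forall v, 'D_v (fun x => row_mx (f x) (g x)) u = row_mx ('D_v f u) ('D_v g u).
Proof.
move=> df dg.
pose il : 'rV[R]_m -> 'rV[R]_(m + n) := fun a => row_mx a 0.
pose ir : 'rV[R]_n -> 'rV[R]_(m + n) := fun b => row_mx 0 b.
have il_lin : linear il.
  by move=> c a b; rewrite /il scale_row_mx add_row_mx scaler0 addr0.
have ir_lin : linear ir.
  by move=> c a b; rewrite /ir scale_row_mx add_row_mx scaler0 addr0.
pose ilM := GRing.isLinear.Build _ _ _ _ _ il_lin.
pose ilL : {linear _ -> _} := HB.pack il ilM.
pose irM := GRing.isLinear.Build _ _ _ _ _ ir_lin.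
pose irL : {linear _ -> _} := HB.pack ir irM.
have cl : continuous il.
  move=> a; apply: (@row_mx_continuous2 _ _ _ idfun (cst 0) a).
    exact: cvg_id.
  exact: cst_continuous.
have cr : continuous ir.
  move=> a; apply: (@row_mx_continuous2 _ _ _ (cst 0) idfun a).
    exact: cst_continuous.
  exact: cvg_id.
have -> : (fun x => row_mx (f x) (g x)) = (ilL \o f) + (irL \o g).
  by apply/funext => x; rewrite /= /il /ir -[RHS]/(_ + _) add_row_mx addr0 add0r.
have dl : differentiable (ilL \o f) u.
  by apply: differentiable_comp => //; exact: linear_differentiable.
have dr : differentiable (irL \o g) u.
  by apply: differentiable_comp => //; exact: linear_differentiable.
have dlr : differentiable ((ilL \o f) + (irL \o g)) u by exact: differentiableD.
split=> [//|v]; rewrite (deriveE v dlr) (deriveE v df) (deriveE v dg).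
have E1 : 'd (ilL \o f) u = il \o 'd f u :> (V -> _).
  by rewrite (diff_comp df); [rewrite diff_lin|exact: linear_differentiable].
have E2 : 'd (irL \o g) u = ir \o 'd g u :> (V -> _).
  by rewrite (diff_comp dg); [rewrite diff_lin|exact: linear_differentiable].
have E1v : 'd (ilL \o f) u v = il ('d f u v) := congr1 (@^~ v) E1.
have E2v : 'd (irL \o g) u v = ir ('d g u v) := congr1 (@^~ v) E2.
have D := congr1 (@^~ v) (diffD dl dr).
apply: (etrans D); apply: (etrans (congr2 +%R E1v E2v)).
by rewrite /il /ir add_row_mx addr0 add0r.
Qed.

Lemma Ck_on_row_mx m1 m2 n1 n2 k (U1 : set 'rV[R]_m1) (U2 : set 'rV[R]_m2)
    (f1 : 'rV[R]_m1 -> 'rV[R]_n1) (f2 : 'rV[R]_m2 -> 'rV[R]_n2) :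
  open U1 -> open U2 -> Ck_on U1 k f1 -> Ck_on U2 k f2 ->
  Ck_on [set u | U1 (lsubmx u) /\ U2 (rsubmx u)] k
    (fun u => row_mx (f1 (lsubmx u)) (f2 (rsubmx u))).
Proof.
move=> oU1 oU2.
have oU : open [set u : 'rV[R]_(m1 + m2) | U1 (lsubmx u) /\ U2 (rsubmx u)].
  apply: openI.
    by apply: open_comp => // u _; exact: continuous_lsubmx.
  by apply: open_comp => // u _; exact: continuous_rsubmx.
elim: k f1 f2 => [|k IHk] f1 f2 /=.
  move=> c1 c2 u [U1u U2u]; apply: row_mx_continuous2.
    apply: (@continuous_comp _ _ _ lsubmx f1); last exact: c1.
    exact: continuous_lsubmx.
  apply: (@continuous_comp _ _ _ rsubmx f2); last exact: c2.
  exact: continuous_rsubmx.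
move=> [d1 D1] [d2 D2].
have dl u : U1 (lsubmx u) ->
    differentiable (f1 \o (lsubmx : 'rV[R]_(m1 + m2) -> _)) u.
  move=> /d1 df; apply: differentiable_comp => //.
  exact: differentiable_lsubmx.
have dr u : U2 (rsubmx u) ->
    differentiable (f2 \o (rsubmx : 'rV[R]_(m1 + m2) -> _)) u.
  move=> /d2 df; apply: differentiable_comp => //.
  exact: differentiable_rsubmx.
split=> [u [U1u U2u]|v].
  exact: (differentiable_row_mx (dl _ U1u) (dr _ U2u)).1.
apply: (Ck_on_ext oU _ (IHk _ _ (D1 (lsubmx v)) (D2 (rsubmx v)))).
move=> u [U1u U2u]; rewrite (differentiable_row_mx (dl _ U1u) (dr _ U2u)).2.
rewrite (deriveE v (dl _ U1u)) (deriveE v (dr _ U2u)).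
rewrite (deriveE _ (d1 _ U1u)) (deriveE _ (d2 _ U2u)).
rewrite (diff_comp _ (d1 _ U1u)); last exact: differentiable_lsubmx.
rewrite (diff_comp _ (d2 _ U2u)); last exact: differentiable_rsubmx.
rewrite /= !diff_lin //; first exact: continuous_rsubmx.
exact: continuous_lsubmx.
Qed.

Lemma transition_open (T : topologicalType) n (a b : chart R T n) :
  open (cmap a @` (cdom a `&` cdom b)).
Proof.
rewrite (_ : _ @` _ = cmap a @` cdom a `&` cinv a @^-1` cdom b); last first.
  rewrite eqEsubset; split=> [_ [p [ap bp] <-]|u [[p ap <-]]].
    by split=> /=; [exists p | rewrite cmapK].
  by rewrite /= cmapK // => bp; exists p.
rewrite openE => u [Iu bu]; apply: filterI.
  by apply: open_nbhs_nbhs; split => //; exact: cimg_open.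
by apply: (cinv_continuous Iu); apply: open_nbhs_nbhs; split => //; exact: cdom_open.
Qed.

Section ProductChart.
Variables (S T : topologicalType) (m n : nat) (a : chart R S m) (b : chart R T n).

Let dom := cdom a `*` cdom b.
Let map (p : S * T) : 'rV[R]_(m + n) := row_mx (cmap a p.1) (cmap b p.2).
Let inv (u : 'rV[R]_(m + n)) : S * T := (cinv a (lsubmx u), cinv b (rsubmx u)).

Lemma row_mx_image (A : set S) (B : set T) (f : S -> 'rV[R]_m) (g : T -> 'rV[R]_n) :
  (fun p : S * T => row_mx (f p.1) (g p.2)) @` (A `*` B) =
  [set u | (f @` A) (lsubmx u) /\ (g @` B) (rsubmx u)].
Proof.
rewrite eqEsubset; split=> [_ [[x y] [/= Ax By] <-]|u [[x Ax xu] [y By yu]]].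
  by rewrite /= row_mxKl row_mxKr; split; [exists x | exists y].
by exists (x, y) => //=; rewrite xu yu hsubmxK.
Qed.

Fact prod_dom_open : open dom.
Proof. by apply: open_prod; exact: cdom_open. Qed.

Fact prod_img_open : open (map @` dom).
Proof.
rewrite row_mx_image; apply: openI.
  apply: (@open_comp _ _ lsubmx (cmap a @` cdom a)); last exact: cimg_open.
  by move=> u _; exact: continuous_lsubmx.
apply: (@open_comp _ _ rsubmx (cmap b @` cdom b)); last exact: cimg_open.
by move=> u _; exact: continuous_rsubmx.
Qed.

Fact prod_mapK p : dom p -> inv (map p) = p.
Proof.
by case: p => x y [/= ax yb]; rewrite /inv /map /= row_mxKl row_mxKr !cmapK.
Qed.

Fact prod_map_continuous p : dom p -> {for p, continuous map}.
Proof.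
case: p => x y [/= ax yb]; apply: row_mx_continuous2.
  apply: (@continuous_comp _ _ _ fst (cmap a)); first exact: cvg_fst.
  exact: cmap_continuous.
apply: (@continuous_comp _ _ _ snd (cmap b)); first exact: cvg_snd.
exact: cmap_continuous.
Qed.

Fact prod_inv_continuous u : (map @` dom) u -> {for u, continuous inv}.
Proof.
rewrite row_mx_image => -[ul ur]; apply: pair_continuous.
  apply: (@continuous_comp _ _ _ lsubmx (cinv a)).
    exact: continuous_lsubmx.
  exact: cinv_continuous.
apply: (@continuous_comp _ _ _ rsubmx (cinv b)).
  exact: continuous_rsubmx.
exact: cinv_continuous.
Qed.

Definition prod_chart : chart R (S * T)%type (m + n) :=
  Chart prod_dom_open prod_img_open prod_mapK
    prod_map_continuous prod_inv_continuous.

End ProductChart.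

Lemma prod_chart_compat (S T : topologicalType) m n (a a' : chart R S m)
    (b b' : chart R T n) :
  smooth_transition a a' -> smooth_transition b b' ->
  smooth_transition (prod_chart a b) (prod_chart a' b').
Proof.
move=> sa sb k; rewrite /= -setXI row_mx_image.
exact: (Ck_on_row_mx (@transition_open _ _ a a') (@transition_open _ _ b b')
  (sa k) (sb k)).
Qed.

Fact prod_chart_at_dom (M N : manifold R) (pq : M * N) :
  cdom (prod_chart (chart_at pq.1) (chart_at pq.2)) pq.
Proof. by split; exact: chart_at_dom. Qed.

(* With this atlas, [tangent (p, q)] is [tangent p] times [tangent q], the pair
   [(v, w)] being written [row_mx v w]. *)
Definition prod_manifold (M N : manifold R) : manifold R :=
  Manifold
    (hausdorff_prod (@mtop_hausdorff _ M) (@mtop_hausdorff _ N))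
    (second_countable_prod
      (@mtop_second_countable _ M) (@mtop_second_countable _ N))
    (@prod_chart_at_dom M N)
    (fun p q : M * N => prod_chart_compat
      (chart_at_compat p.1 q.1) (chart_at_compat p.2 q.2)).

End Product.

(* An immersed submanifold with underlying set [S]; it is embedded when its
   topology is the one induced by [M]. *)
Record submanifold (R : realType) (M : manifold R) (S : set M) := Submanifold {
  sub_manifold :> manifold R;
  sub_incl : sub_manifold -> M;
  sub_immersion : immersion sub_incl;
  sub_inj : injective sub_incl;
  sub_range : range sub_incl = S }.

Arguments sub_incl {R M S} s _.

Definition embedded (R : realType) (M : manifold R) (S : set M)
    (N : submanifold S) : Prop :=
  forall U : set N, open U -> exists2 V : set M, open V & U = sub_incl N @^-1` V.

Definition sub_tangent (R : realType) (M : manifold R) (S : set M)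
    (N : submanifold S) (p : N) : {vspace tangent (sub_incl N p)} :=
  limg (mdiff (sub_incl N) p).

Definition normal_space (R : realType) (M : manifold R) (S : set M)
    (N : submanifold S) (p : N) : zmodType :=
  Quotient.quot (sub_tangent p).

Definition normal_class (R : realType) (M : manifold R) (S : set M)
    (N : submanifold S) (p : N) (v : tangent (sub_incl N p)) : normal_space p :=
  \pi_(Quotient.quot (sub_tangent p)) v.

(* [gmul g h] is the composite of [h] followed by [g]; it is only meaningful when
   [gsrc g = gtgt h].  The smoothness of the multiplication is that of its
   restriction to the embedded submanifold of composable pairs. *)
Record lie_groupoid (R : realType) := LieGroupoid {
  ob : manifold R;
  ar : manifold R;
  gsrc : ar -> ob;
  gtgt : ar -> ob;
  gunit : ob -> ar;
  ginv : ar -> ar;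
  gmul : ar -> ar -> ar;
  gsrc_submersion : submersion gsrc;
  gtgt_submersion : submersion gtgt;
  gsrc_surjective : range gsrc = setT;
  gtgt_surjective : range gtgt = setT;
  gunit_smooth : smooth gunit;
  ginv_smooth : smooth ginv;
  composable :
    @submanifold R (prod_manifold ar ar) [set gh | gsrc gh.1 = gtgt gh.2];
  composable_embedded : embedded composable;
  gmul_smooth : @smooth R composable ar
    (fun c => gmul (sub_incl composable c).1 (sub_incl composable c).2);
  gsrc_mul : forall g h, gsrc g = gtgt h -> gsrc (gmul g h) = gsrc h;
  gtgt_mul : forall g h, gsrc g = gtgt h -> gtgt (gmul g h) = gtgt g;
  gmulA : forall g h k, gsrc g = gtgt h -> gsrc h = gtgt k ->
    gmul g (gmul h k) = gmul (gmul g h) k;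
  gsrc_unit : forall x, gsrc (gunit x) = x;
  gtgt_unit : forall x, gtgt (gunit x) = x;
  gmul_unitl : forall g, gmul (gunit (gtgt g)) g = g;
  gmul_unitr : forall g, gmul g (gunit (gsrc g)) = g;
  gsrc_inv : forall g, gsrc (ginv g) = gtgt g;
  gtgt_inv : forall g, gtgt (ginv g) = gsrc g;
  gmul_invl : forall g, gmul (ginv g) g = gunit (gsrc g);
  gmul_invr : forall g, gmul g (ginv g) = gunit (gtgt g) }.

Arguments gsrc {R l} _.
Arguments gtgt {R l} _.

Section LieGroupoidTheory.
Variables (R : realType) (G : lie_groupoid R).
Implicit Types x y : ob G.

Definition gsrc_fibre x : set (ar G) := [set g | gsrc g = x].

Definition arrows y x : set (ar G) := [set g | gsrc g = x /\ gtgt g = y].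

Definition lg_orbit x : set (ob G) := gtgt @` gsrc_fibre x.

Definition anchor : ar G -> prod_manifold (ob G) (ob G) :=
  fun g => (gtgt g, gsrc g).

(* The smooth structure of the orbit is that of the quotient of the source
   fibre by the right action of the isotropy group: the classes of this action
   are the fibres of [gtgt] on the source fibre, and the quotient structure is
   the one for which the induced projection is a submersion. *)
Definition orbit_structure x (O : submanifold (lg_orbit x)) : Prop :=
  exists F : submanifold (gsrc_fibre x), embedded F /\
  exists2 q : F -> O, submersion q &
    forall h, sub_incl O (q h) = gtgt (sub_incl F h).

(* The map sending the class of [w] to the class of [d_g gtgt xi], for any [xi]
   with [d_g gsrc xi = w]; the arrow [g] goes from the point [a] to the point [b]
   of the orbit.  The class obtained is independent of the choices, so that
   [xget] only serves as a description operator. *)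
Definition normal_rep x (O : submanifold (lg_orbit x)) (a b : O) (g : ar G)
    (c : normal_space a) : normal_space b :=
  xget 0 [set c' | exists (w : tangent (sub_incl O a)) (xi : tangent g),
    [/\ normal_class w = c, mdiff gsrc g xi = w &
        normal_class (mdiff gtgt g xi : tangent (sub_incl O b)) = c']].

End LieGroupoidTheory.

Arguments normal_rep {R G x O} a b g c.
Arguments anchor {R G} _.

(* Main.v *)
(* Both statements come from two facts about tangent vectors.  First, a vector
   killed by the differential of a submersion is a limiting direction of points
   of its fibre (a quantitative open mapping argument).  Second, a limiting
   direction of points of an embedded submanifold is tangent to it.
   Applied to the source map, they give ker d_g s = T_g s^-1(x), whence
   T_yO = d_g t (ker d_g s); applied to the projection s^-1(x) -> O, they give
   ker d_g rho = T_g G(y,x).  Applied to the composable pairs, they show that if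
   d_g s (xi) = d_1x t (zeta), then (xi, zeta) is tangent to them; when moreover
   d_1x s (zeta) = 0, the image of (xi, zeta) under the differential of the
   multiplication lies in ker d_g s and has the same image under d_g t as xi, so
   that eta_g is well defined. *)
From HB Require Import structures.
Require Import Defs.
From mathcomp Require Import all_boot all_order all_algebra ring_quotient.
From mathcomp Require Import all_classical all_reals all_analysis.
From mathcomp Require Import ring lra.

Set Implicit Arguments.
Unset Strict Implicit.
Unset Printing Implicit Defensive.

Import Order.TTheory GRing.Theory Num.Theory.
Import numFieldNormedType.Exports.

Local Open Scope classical_set_scope.
Local Open Scope ring_scope.

(* Joins the existing structures into a [completeNormedModType]. *)
HB.instance Definition _ (R : realType) m n :=
  NormedModule.on 'M[R]_(m, n).

(** * Norm estimates and strict differentiability in coordinate spaces *)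

Section Euclidean.
Variable R : realType.

Lemma le_coord_norm m n (u : 'M[R]_(m, n)) i j : `|u i j| <= `|u|.
Proof.
rewrite [leRHS]/Num.Def.normr /= mx_normrE.
exact: (le_bigmax _ (fun ij => `|u ij.1 ij.2|) (i, j)).
Qed.

Lemma norm_le_coord m n (u : 'M[R]_(m, n)) e :
  0 <= e -> (forall i j, `|u i j| <= e) -> `|u| <= e.
Proof.
by move=> e0 ue; rewrite [leLHS]/Num.Def.normr /= mx_normrE bigmax_le.
Qed.

Lemma norm_lin_le m (W : normedModType R) (f : {linear 'rV[R]_m -> W})
    (e : 'I_m -> R) (u : 'rV[R]_m) :
  (forall i, `|f (delta_mx 0 i)| <= e i) -> `|f u| <= (\sum_i e i) * `|u|.
Proof.
move=> fe; rewrite [u in leLHS]row_sum_delta linear_sum /=.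
apply: le_trans (ler_norm_sum _ _ _) _; rewrite mulr_suml ler_sum // => i _.
by rewrite linearZ /= normrZ mulrC ler_pM // le_coord_norm.
Qed.

Lemma rV_linear_bounded m (W : normedModType R) (f : {linear 'rV[R]_m -> W}) :
  exists2 c, 0 < c & forall u, `|f u| <= c * `|u|.
Proof.
exists (1 + \sum_i `|f (delta_mx 0 i)|) => [|u].
  by rewrite ltr_pwDl // sumr_ge0.
by apply: le_trans (norm_lin_le _ (fun=> lexx _)) _; rewrite ler_wpM2r // lerDr.
Qed.

(** Both points vary, so that for linear [L] the map [f - L] is Lipschitz near [p] with an
    arbitrarily small constant, as a contraction argument requires. *)
Definition strict_diff (V W : normedModType R) (f : V -> W) (p : V)
    (L : V -> W) :=
  forall e, 0 < e -> exists2 d, 0 < d & forall u u', `|u - p| < d ->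
    `|u' - p| < d -> `|f u - f u' - L (u - u')| <= e * `|u - u'|.

(** The norm is the largest coordinate, so the scalar mean value theorem along the segment is
    applied to each coordinate. *)
Lemma rV_mean_value (V : normedModType R) n (f : V -> 'rV[R]_n) (u u' : V)
    (e : R) :
  0 <= e ->
  (forall s : R, 0 <= s <= 1 -> differentiable f (u' + s *: (u - u')) /\
     `|'d f (u' + s *: (u - u')) (u - u')| <= e) ->
  `|f u - f u'| <= e.
Proof.
move=> e0 fe; apply: norm_le_coord => // i j; rewrite !mxE.
set w := u - u' in fe *.
pose c : R -> V := fun s => u' + s *: w.
pose phi (s : R) := f (c s) i j.
have dc s : is_diff s c ( *:%R^~ w).
  have dw : is_diff s ( *:%R^~ w : R -> V) ( *:%R^~ w) by exact: is_diff_scalel.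
  exact: is_diff_eq (is_diffD (is_diff_cst u' s) dw) (add0r _).
have dphi (s : R) : 0 <= s <= 1 -> is_derive s 1 phi ('d f (c s) w i j).
  move=> s01; have [df _] := fe s s01.
  have E : is_diff s phi (fun h => ('d f (c s) (h *: w)) i j).
    pose co : 'rV[R]_n -> R := fun v => v i j.
    have [col coE] : exists col : {linear 'rV[R]_n -> R}, col = co :> (_ -> _).
      have lc : linear co by move=> a x y; rewrite /co !mxE.
      pose cM := GRing.isLinear.Build _ _ _ _ _ lc.
      pose col : {linear 'rV[R]_n -> R} := HB.pack co cM.
      by exists col.
    have cc : continuous col by rewrite coE; exact: coord_continuous.
    have dco x : is_diff x co co.
      apply: DiffDef; rewrite -coE; first exact: linear_differentiable.
      by rewrite diff_lin.
    have dfc : is_diff (c s) f ('d f (c s)) by exact: differentiableP.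
    have h1 := is_diff_comp (dc s) dfc.
    exact: is_diff_comp h1 (dco _).
  apply: DeriveDef; first by apply: diff_derivable; exact: ex_diff.
  by rewrite deriveE ?diff_val ?scale1r //; exact: ex_diff.
have [||x x01] := @MVT_segment R phi (fun s => 'd f (c s) w i j) 0 1 ler01.
- move=> x; rewrite in_itv /= => /andP[/ltW x0 /ltW x1].
  by apply: dphi; rewrite x0.
- apply: derivable_within_continuous => x; rewrite in_itv /= => x01.
  by have := dphi x x01 => H; exact: ex_derive.
rewrite subr0 mulr1 /phi /c scale1r scale0r addr0 [u' + w]addrC subrK => ->.
by apply: le_trans (le_coord_norm _ _ _) _; exact: (fe x _).2.
Qed.

(** Mean value inequality for [f - 'd f p], whose differential is small near [p] by continuity of
    the partial derivatives. *)
Lemma C1_strict_diff m n (U : set 'rV[R]_m) (f : 'rV[R]_m -> 'rV[R]_n) p :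
  open U -> U p -> Ck_on U 1 f -> strict_diff f p ('d f p).
Proof.
move=> oU Up [df cDf] e e0.
(* The bounds on [m] partial derivatives get summed; [m.+1] avoids a division by 0 when [m = 0]. *)
pose e' := e / m.+1%:R.
have e'0 : 0 < e' by rewrite divr_gt0.
have /nbhs_normP[d /= d0 dP] : \forall z \near p, U z /\
    forall i, `|'D_(delta_mx 0 i) f z - 'D_(delta_mx 0 i) f p| <= e'.
  apply: filterI; first by apply: open_nbhs_nbhs.
  apply: (@filter_forall _ _
    (fun i z => `|'D_(delta_mx 0 i) f z - 'D_(delta_mx 0 i) f p| <= e')
    _ (nbhs_filter p)) => i.
  have /cvgrPdist_le/(_ e' e'0) := cDf (delta_mx 0 i) p Up.
  by apply: filterS => z zP; rewrite distrC; exact: zP.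
exists d => // u u' ud u'd.
pose L := 'd f p.
have cL : continuous L by apply: diff_continuous; exact: df.
pose h : 'rV[R]_m -> 'rV[R]_n := f - (L : 'rV[R]_m -> 'rV[R]_n).
have dh z : U z -> differentiable h z /\ forall v, 'd h z v = 'd f z v - L v.
  move=> Uz; have dfz := df z Uz.
  have dL : differentiable L z by exact: linear_differentiable.
  split=> [|v]; first exact: differentiableB.
  apply: (etrans (congr1 (@^~ v) (diffB dfz dL))).
  exact: (congr1 (fun g : 'rV[R]_m -> 'rV[R]_n => 'd f z v - g v)
    (diff_lin _ cL)).
suff : `|h u - h u'| <= e * `|u - u'|.
  rewrite -[h u]/(f u - L u) -[h u']/(f u' - L u') (linearB L) -/L.
  congr (`| _ | <= _).
  apply/rowP => k; rewrite !mxE. ring.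
apply: rV_mean_value => [|s /andP[s0 s1]]; first by rewrite mulr_ge0 // ltW.
set z := u' + _.
have zd : `|p - z| < d.
  have -> : p - z = - ((1 - s) *: (u' - p) + s *: (u - p)).
    by apply/rowP => k; rewrite !mxE; ring.
  rewrite normrN; apply: le_lt_trans (ler_normD _ _) _; rewrite !normrZ.
  rewrite [`|1 - s|]ger0_norm ?subr_ge0 // [`|s|]ger0_norm //.
  apply: (@le_lt_trans _ _ (Num.max `|u' - p| `|u - p|)); last first.
    by rewrite gt_max u'd.
  set M := Num.max _ _.
  rewrite [leRHS](_ : M = (1 - s) * M + s * M); last by ring.
  rewrite lerD // ler_wpM2l //.
  - by rewrite subr_ge0.
  - by rewrite le_max lexx.
  - by rewrite le_max lexx orbT.
have [Uz zP] := dP z zd.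
split; first exact: (dh z Uz).1.
rewrite (dh z Uz).2.
pose K : {linear 'rV[R]_m -> 'rV[R]_n} := 'd f z \- L.
apply: le_trans (@norm_lin_le _ _ K (fun=> e') _ _) _.
  move=> i; have Ei := deriveE (delta_mx 0 i) (df z Uz).
  have Ep := deriveE (delta_mx 0 i) (df p Up).
  have := zP i; rewrite Ei Ep; exact.
rewrite sumr_const card_ord -mulr_natr ler_wpM2r // /e' -mulrA ger_pMr //.
by rewrite ler_pdivrMl // mulr1 ler_nat.
Qed.
End Euclidean.

(** * Level sets of maps with surjective differential *)

Section LevelSet.
Variable R : realType.

Lemma linear_surj_section m n (L : {linear 'rV[R]_m -> 'rV[R]_n}) :
  (forall w, exists u, L u = w) ->
  exists A : {linear 'rV[R]_n -> 'rV[R]_m}, cancel A L.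
Proof.
move=> Ls; exists (mulmxr (pinvmx (lin1_mx L))) => w /=.
rewrite -mul_rV_lin1 mulmxKpV //; have [u <-] := Ls w.
by rewrite -mul_rV_lin1 submxMl.
Qed.

Lemma linear_inj_retraction m n (L : {linear 'rV[R]_m -> 'rV[R]_n}) :
  (forall u, L u = 0 -> u = 0) ->
  exists B : {linear 'rV[R]_n -> 'rV[R]_m}, cancel L B.
Proof.
move=> Li; exists (mulmxr (pinvmx (lin1_mx L))) => u /=.
rewrite -mul_rV_lin1 -mulmxA mulmxVp ?mulmx1 //.
by apply: inj_row_free => v; rewrite mul_rV_lin1; exact: Li.
Qed.

Lemma closed_norm_ball (V : normedModType R) (r : R) :
  closed [set z : V | `|z| <= r].
Proof.
apply: (@closed_comp _ _ (fun z : V => `|z|) [set x | x <= r]).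
  by move=> z _; exact: norm_continuous.
exact: closed_le.
Qed.

(** Banach's fixed point theorem on a closed ball, which the bound on [f 0] and the contraction
    estimate together make stable. *)
Lemma contraction_fixpoint n (r : R) (f : 'rV[R]_n -> 'rV[R]_n) :
  0 <= r ->
  (forall z z', `|z| <= r -> `|z'| <= r -> `|f z - f z'| <= 2^-1 * `|z - z'|) ->
  `|f 0| <= r / 2 -> exists2 z, `|z| <= r & f z = z.
Proof.
move=> r0 fl f0.
have fS : {homo f : z / [set z | `|z| <= r] z >-> [set z | `|z| <= r] z}.
  move=> z /= zr; rewrite -[f z](subrK (f 0)) (le_trans (ler_normD _ _)) //.
  have := fl z 0 zr; rewrite normr0 subr0 => /(_ r0); lra.
have [||z zr fz] := @banach_fixed_point R 'rV[R]_n _ (mkfun_fun fS) _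
    (@closed_norm_ball _ r).
- exists (2^-1)%:nng; split=> /=; first by rewrite invf_lt1 ?ltr1n.
  by move=> [z z'] [/= zr zr']; exact: fl.
- by exists 0; rewrite /= normr0.
by exists z => //; rewrite [in RHS]fz.
Qed.

(* With [A] a section of [L], the equation [f (p + t v + A z) = f p] says that
   [z] is fixed by the contraction [z |-> z - (f (p + t v + A z) - f p)]. *)
Lemma level_set_tangent m n (f : 'rV[R]_m -> 'rV[R]_n) p
    (L : {linear 'rV[R]_m -> 'rV[R]_n}) v :
  strict_diff f p L -> (forall w, exists u, L u = w) -> L v = 0 ->
  forall e : R, 0 < e -> exists2 d : R, 0 < d & forall t : R, `|t| < d ->
    exists2 x, f x = f p & `|x - p - t *: v| <= e * `|t|.
Proof.
move=> sf Ls Lv0 e e0.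
have [A LA] := linear_surj_section Ls.
have [c c0 cA] := rV_linear_bounded A.
have nv : 0 < `|v| + e by rewrite ltr_wpDl.
(* The first bound makes the map a contraction of ratio 1/2; the second keeps the image of 0 within
   [r / 2], for the radius [r] below. *)
pose eta := Num.min (2^-1 / c) (e / (2 * c * (`|v| + e))).
have eta0 : 0 < eta by rewrite lt_min !divr_gt0 ?mulr_gt0.
have [d0 d00 fd] := sf eta eta0.
have etac : eta * c <= 2^-1 by rewrite -ler_pdivlMr // ge_min lexx.
have etav : eta * `|v| <= e / c / 2.
  apply: (@le_trans _ _ (e / (2 * c * (`|v| + e)) * (`|v| + e))).
    by rewrite ler_pM ?(ltW eta0) // ?ge_min ?lexx ?orbT // lerDl ltW.
  rewrite le_eqVlt; apply/orP; left; apply/eqP; field.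
  by rewrite !gt_eqF.
exists (d0 / (`|v| + e)) => [|t td]; first by rewrite divr_gt0.
rewrite ltr_pdivlMr // in td.
pose r := e * `|t| / c.
have r0 : 0 <= r by rewrite !mulr_ge0 ?invr_ge0 // ltW.
pose x z := p + t *: v + A z.
have xd z : `|z| <= r -> `|x z - p| < d0.
  move=> zr; apply: le_lt_trans td.
  have -> : x z - p = t *: v + A z.
    by apply/rowP => k; rewrite !mxE; ring.
  apply: le_trans (ler_normD _ _) _; rewrite normrZ mulrDr lerD2l.
  apply: le_trans (cA z) _; rewrite mulrC -ler_pdivlMr //.
  by rewrite (le_trans zr) // /r [e * _]mulrC.
have [||z zr fz] := @contraction_fixpoint _ r (fun z => z - (f (x z) - f p)) r0.
- move=> z z' zr z'r; have := fd _ _ (xd z zr) (xd z' z'r).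
  have -> : x z - x z' = A (z - z').
    by rewrite linearB /x; apply/rowP => k; rewrite !mxE; ring.
  rewrite LA => H.
  have -> : z - (f (x z) - f p) - (z' - (f (x z') - f p)) =
      - (f (x z) - f (x z') - (z - z')) by apply/rowP => k; rewrite !mxE; ring.
  rewrite normrN (le_trans H) //.
  apply: (@le_trans _ _ (eta * (c * `|z - z'|))); first by rewrite ler_pM2l.
  by rewrite mulrA ler_wpM2r.
- have p0 : `|p - p| < d0 by rewrite subrr normr0.
  have := fd _ _ (xd 0 _) p0; rewrite normr0 => /(_ r0).
  have -> : x 0 - p = t *: v.
    by rewrite /x linear0 addr0 addrC addKr.
  rewrite linearZ /= Lv0 scaler0 subr0 sub0r normrN => /le_trans; apply.
  rewrite normrZ mulrCA.
  rewrite (_ : r / 2 = `|t| * (e / c / 2)); last by rewrite /r; ring.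
  by rewrite ler_wpM2l.
exists (x z).
  apply/eqP; rewrite -subr_eq0 -oppr_eq0; apply/eqP/(addrI z).
  by rewrite fz addr0.
have -> : x z - p - t *: v = A z by apply/rowP => k; rewrite !mxE; ring.
apply: le_trans (cA z) _; rewrite mulrC -ler_pdivlMr //.
Qed.
End LevelSet.

(** * Differentials in charts and limiting directions on manifolds *)

Lemma diff_first_order (R : realType) (V W : normedModType R) (f : V -> W)
    (a : V) :
  differentiable f a -> forall e : R, 0 < e ->
  \forall u \near a, `|f u - f a - 'd f a (u - a)| <= e * `|u - a|.
Proof.
move=> /diff_locally/eqaddoP H e e0.
rewrite (near_shift 0) /=; have := H e e0.
apply: filterS => x /=; rewrite subr0.
rewrite -![(_ - _) x]/(_ x - _ x) -![(_ + _) x]/(_ x + _ x) /=.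
by rewrite addrK opprD addrA.
Qed.

Section Manifolds.
Variable R : realType.

Lemma chart_nbhs (T : topologicalType) n (c : chart R T n) p (U : set T) :
  cdom c p -> nbhs p U ->
  \forall u \near cmap c p, [/\ cdom c (cinv c u), U (cinv c u) &
    cmap c (cinv c u) = u].
Proof.
move=> cp Up; have icp : (cmap c @` cdom c) (cmap c p) by exists p.
have cdU : nbhs (cinv c (cmap c p)) (cdom c `&` U).
  rewrite cmapK //; apply: filterI => //.
  by apply: open_nbhs_nbhs; split => //; exact: cdom_open.
have im : nbhs (cmap c p) (cmap c @` cdom c).
  by apply: open_nbhs_nbhs; split => //; exact: cimg_open.
have pre : nbhs (cmap c p) (cinv c @^-1` (cdom c `&` U)).
  exact: (cinv_continuous icp).
apply: filterS (filterI im pre) => u [[q cq <-] [/= cu Uu]].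
by split => //; rewrite cmapK.
Qed.

Lemma chart_image_open (T : topologicalType) n (c : chart R T n) (A : set T) :
  open A -> open (cmap c @` (cdom c `&` A)).
Proof.
move=> oA; rewrite openE => _ [p [cp Ap] <-].
apply: filterS (chart_nbhs cp (open_nbhs_nbhs (conj oA Ap))) => u [cu Au <-].
by exists (cinv c u).
Qed.

Implicit Types M N P : manifold R.

Definition coords M (p : M) : M -> 'rV[R]_(mdim M) := cmap (chart_at p).

Definition mdifferentiable M N (f : M -> N) (p : M) : Prop :=
  {for p, continuous f} /\ differentiable (local_rep f p (f p)) (coords p p).

(* [mdiff f p] as a map between coordinate spaces: tangent spaces at provably
   equal points then have the same type, also syntactically. *)
Definition tmap M N (f : M -> N) (p : M) :
    {linear 'rV[R]_(mdim M) -> 'rV[R]_(mdim N)} :=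
  'd (local_rep f p (f p)) (coords p p).

Lemma mdiffE M N (f : M -> N) (p : M) v : mdiff f p v = tmap f p v.
Proof. exact: lfunE. Qed.

(** Any point [q] whose chart contains [f p] is allowed, so that source and target can be compared
    in one chart. *)
Lemma smooth_strict_diff M N (f : M -> N) (p : M) (q : N) :
  smooth f -> cdom (chart_at q) (f p) ->
  differentiable (local_rep f p q) (coords p p) /\
  strict_diff (local_rep f p q) (coords p p)
    ('d (local_rep f p q) (coords p p)).
Proof.
move=> [cf sf] qfp.
have oU : open (cmap (chart_at p) @`
    (cdom (chart_at p) `&` f @^-1` cdom (chart_at q))).
  apply: chart_image_open; apply: open_comp; last exact: cdom_open.
  by move=> ? _; exact: cf.
have Up : (cmap (chart_at p) @`
    (cdom (chart_at p) `&` f @^-1` cdom (chart_at q))) (coords p p).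
  by exists p => //; split => //; exact: chart_at_dom.
split; first by case: (sf p q 1%N) => + _; exact.
exact: C1_strict_diff oU Up (sf p q 1%N).
Qed.

Lemma smooth_mdifferentiable M N (f : M -> N) (p : M) :
  smooth f -> mdifferentiable f p.
Proof.
move=> sf; split; first exact: sf.1.
by apply: (smooth_strict_diff sf _).1; exact: chart_at_dom.
Qed.

Lemma near_eq_diff (V W : normedModType R) (f g : V -> W) (a : V) :
  (\near a, f a = g a) -> differentiable f a ->
  differentiable g a /\ forall v, 'd g a v = 'd f a v.
Proof.
move=> fg df; have dg := near_eq_differentiable fg df.
split=> [|v]; first exact: dg.
rewrite -(deriveE v dg) -(deriveE v df); apply: near_eq_derive.
by apply: filterS fg => x ->.
Qed.

Lemma submersion_surj M N (f : M -> N) (p : M) (w : 'rV[R]_(mdim N)) :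
  submersion f -> exists u, tmap f p u = w.
Proof.
move=> [_ fs]; have : w \in limg (mdiff f p) by rewrite fs memvf.
by move=> /memv_imgP[u _ ->]; exists u; rewrite mdiffE.
Qed.

(** Chain rule: by continuity [f] stays in the chart at [f p], so the local representatives compose
    near [p]. *)
Lemma tmap_comp M N P (f : M -> N) (g : N -> P) (p : M) :
  mdifferentiable f p -> mdifferentiable g (f p) ->
  mdifferentiable (g \o f) p /\
  forall v, tmap (g \o f) p v = tmap g (f p) (tmap f p v).
Proof.
move=> [cf df] [cg dg].
have fp : local_rep f p (f p) (coords p p) = coords (f p) (f p).
  by rewrite /local_rep /coords /= cmapK //; exact: chart_at_dom.
rewrite -fp in dg.
have dgf := differentiable_comp df dg.
have E : \forall u \near coords p p,
    (local_rep g (f p) (g (f p)) \o local_rep f p (f p)) u =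
    local_rep (g \o f) p (g (f p)) u.
  have Vn : nbhs p (f @^-1` cdom (chart_at (f p))).
    apply: cf; apply: open_nbhs_nbhs; split; first exact: cdom_open.
    exact: chart_at_dom.
  apply: filterS (chart_nbhs (chart_at_dom p) Vn) => u [_ /= Vu _].
  by rewrite /local_rep /= cmapK.
have [dl El] := near_eq_diff E dgf.
split=> [|v]; first by split => //; exact: continuous_comp.
rewrite /tmap El; apply: (etrans (congr1 (@^~ v) (diff_comp df dg))).
by rewrite /= fp.
Qed.

Lemma tmap_cst M N (q : N) (p : M) v : tmap (fun=> q) p v = 0.
Proof.
rewrite /tmap (_ : local_rep _ _ _ = cst (cmap (chart_at q) q)) ?diff_cst //.
Qed.

(** Contingent cone with both signs of [t]; points approach [p] by shrinking [U]. It asks for no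
    smooth structure on [A], and so links fibres to submanifolds. *)
Definition tangent_cone M (p : M) (A : set M) (v : 'rV[R]_(mdim M)) : Prop :=
  forall (e : R) U, 0 < e -> nbhs p U -> exists (t : R) p',
    [/\ t != 0, A p', U p' & `|coords p p' - coords p p - t *: v| <= e * `|t| ].

Lemma tangent_cone_level M (p : M) (A U : set M) n (F : M -> 'rV[R]_n)
    (L : {linear 'rV[R]_(mdim M) -> 'rV[R]_n}) v :
  strict_diff (F \o cinv (chart_at p)) (coords p p) L ->
  (forall w, exists u, L u = w) -> L v = 0 -> nbhs p U ->
  (forall p', U p' -> F p' = F p -> A p') -> tangent_cone p A v.
Proof.
move=> sF Ls Lv0 Up FA e V e0 Vp.
have [r /= r0 rP] := iffLR (nbhs_normP (coords p p) _)
  (chart_nbhs (chart_at_dom p) (filterI Up Vp)).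
have [d d0 dP] := level_set_tangent sF Ls Lv0 e0.
have nv : 0 < `|v| + e by rewrite ltr_wpDl.
(* The first bound makes the level set estimate available; the second keeps [x] within [r / 2] of
   [coords p p], where the chart can be inverted. *)
pose t := Num.min (d / 2) (r / 2 / (`|v| + e)).
have t0 : 0 < t by rewrite lt_min !divr_gt0.
have nt : `|t| = t by rewrite gtr0_norm.
have [|x Fx xv] := dP t.
  by rewrite nt (@le_lt_trans _ _ (d / 2)) ?ge_min ?lexx //; lra.
have [|cx [Ux Vx] cK] := rP x.
  rewrite /ball_ /= -(opprB x) -(subrK (t *: v) (x - _)) normrN.
  rewrite (le_lt_trans (ler_normD _ _)) // normrZ.
  apply: (@le_lt_trans _ _ (t * (`|v| + e))).
    by rewrite nt in xv *; lra.
  apply: (@le_lt_trans _ _ (r / 2)); last by lra.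
  by rewrite -ler_pdivlMr // ge_min lexx orbT.
exists t, (cinv (chart_at p) x); split => //.
- by rewrite gt_eqF.
- apply: FA => //; rewrite [LHS]Fx /= /coords cmapK //; exact: chart_at_dom.
- by rewrite {1}/coords cK.
Qed.

Lemma tangent_cone_fibre M N (f : M -> N) (p : M) v :
  submersion f -> tmap f p v = 0 -> tangent_cone p [set p' | f p' = f p] v.
Proof.
move=> fsub fv0; have sf := fsub.1; have fpd := chart_at_dom (f p).
have [_ st] := smooth_strict_diff sf fpd.
apply: (@tangent_cone_level M p _ (f @^-1` cdom (chart_at (f p))) _
  (coords (f p) \o f) _ v st) => //.
- by move=> w; exact: submersion_surj.
- by apply: sf.1; apply: open_nbhs_nbhs; split => //; exact: cdom_open.
- move=> p' /= fp' E; have := congr1 (cinv (chart_at (f p))) E.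
  by rewrite /= /coords !cmapK.
Qed.

Lemma tangent_cone_image M N (f : M -> N) (p : M) (A : set M) (B : set N) v :
  mdifferentiable f p -> (forall p', A p' -> B (f p')) ->
  tangent_cone p A v -> tangent_cone (f p) B (tmap f p v).
Proof.
move=> [cf df] AB cA e U e0 Up.
pose L := tmap f p.
have [c c0 Lc] := rV_linear_bounded L.
(* Half of [e] pays for the remainder of [f], through [eta], and half for the image under [L] of the
   error on [p'], through [e']. The bound [e' <= 1] controls the displacement of [p'] in terms of
   [t]. *)
have nv : 0 < `|v| + 1 by rewrite ltr_wpDl.
pose eta := e / 2 / (`|v| + 1).
have eta0 : 0 < eta by rewrite !divr_gt0.
pose e' := Num.min 1 (e / 2 / c).
have e'0 : 0 < e' by rewrite lt_min !divr_gt0 ?ltr01.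
have e'1 : e' <= 1 by rewrite ge_min lexx.
have e'c : c * e' <= e / 2 by rewrite mulrC -ler_pdivlMr // ge_min lexx orbT.
have near1 : nbhs p [set p' | `|local_rep f p (f p) (coords p p') -
    local_rep f p (f p) (coords p p) - L (coords p p' - coords p p)|
    <= eta * `|coords p p' - coords p p| ].
  exact: (cmap_continuous (chart_at_dom p) (diff_first_order df eta0)).
have near2 : nbhs p (cdom (chart_at p)).
  by apply: open_nbhs_nbhs; split; [exact: cdom_open|exact: chart_at_dom].
have [t [p' [t0 Ap' [[E cp'] Up'] tv]]] :=
  cA e' _ e'0 (filterI (filterI near1 near2) (cf _ Up)).
exists t, (f p'); split => //; first exact: AB.
rewrite -/L.
have lE q : cdom (chart_at p) q ->
    local_rep f p (f p) (coords p q) = coords (f p) (f q).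
  by move=> qd; rewrite /local_rep /= cmapK.
move: E; rewrite /= !lE //; last exact: chart_at_dom.
set a := coords (f p) (f p') - _; set w := coords p p' - _ => E.
have wv : `|w| <= `|t| * (`|v| + 1).
  rewrite -(subrK (t *: v) w) (le_trans (ler_normD _ _)) // normrZ mulrDr addrC.
  by rewrite lerD2l (le_trans tv) // mulrC ler_wpM2l.
rewrite (_ : a - t *: L v = (a - L w) + L (w - t *: v)); last first.
  have -> : t *: L v = L (t *: v) by rewrite linearZ.
  by rewrite (linearB L w) addrA subrK.
apply: le_trans (ler_normD _ _) _.
rewrite [leRHS](_ : _ = e / 2 * `|t| + e / 2 * `|t|); last by field.
apply: lerD.
  apply: le_trans E _; rewrite (le_trans (ler_wpM2l (ltW eta0) wv)) //.
  rewrite le_eqVlt; apply/orP; left; apply/eqP; rewrite /eta; field.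
  by rewrite gt_eqF.
apply: le_trans (Lc _) _.
apply: (@le_trans _ _ (c * (e' * `|t|))); first by rewrite ler_pM2l.
by rewrite mulrA ler_wpM2r.
Qed.

End Manifolds.

(** * Tangent spaces of submanifolds and products, and normal classes *)

Section Tangent.
Variable R : realType.
Implicit Types M N P : manifold R.

(* The inclusion [i] has an injective differential [L], with retraction [B], so
   that points [p'] of [N] with [i p' = i p + t v + o(t)] are at distance [O(t)]
   of [p]; hence [v] is killed by the projection [v |-> v - L (B v)]. *)
Lemma tangent_cone_sub_tangent M (S : set M) (N : submanifold S) (p : N) v :
  embedded N -> tangent_cone (sub_incl N p) S v -> v \in sub_tangent p.
Proof.
move=> emb cSv; set i := sub_incl N in cSv *.
have [si ki] := sub_immersion N; rewrite -/i in si ki.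
have [_ di] := smooth_mdifferentiable p si.
pose L := tmap i p.
have Li u : L u = 0 -> u = 0.
  move=> Lu0; have : u \in lker (mdiff i p) by rewrite memv_ker mdiffE -/L Lu0.
  by rewrite ki memv0 => /eqP.
have [B LB] := linear_inj_retraction Li.
have [cL cL0 leL] := rV_linear_bounded L.
have [cB cB0 leB] := rV_linear_bounded B.
suff Kv : v - L (B v) = 0.
  have -> : v = mdiff i p (B v).
    by rewrite mdiffE -/L; apply/eqP; rewrite -subr_eq0 Kv.
  by rewrite memv_img ?memvf.
apply/eqP; apply: contraT => Kv; rewrite -normr_gt0 in Kv.
set kappa := `|v - L (B v)| in Kv.
pose ck := 1 + cL * cB.
have ck0 : 0 < ck by rewrite ltr_wpDr ?mulr_ge0 // ltW.
have leK w : `|w - L (B w)| <= ck * `|w|.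
  rewrite (le_trans (ler_normB _ _)) // mulrDl mul1r lerD2l.
  by rewrite (le_trans (leL _)) // -mulrA ler_pM2l.
have nv : 0 < `|v| + 1 by rewrite ltr_wpDl.
(* With [e] and [eta], each of the two final error terms is at most a quarter of [kappa] times the
   size of [t], which contradicts [0 < kappa]. *)
pose e := Num.min 1 (kappa / 4 / ck).
have e0 : 0 < e by rewrite lt_min ltr01 !divr_gt0.
have e1 : e <= 1 by rewrite ge_min lexx.
have eck : ck * e <= kappa / 4.
  by rewrite mulrC -ler_pdivlMr // ge_min lexx orbT.
pose eta := Num.min (2^-1 / cB) (kappa / 8 / (ck * (cB * (`|v| + 1)))).
have eta0 : 0 < eta by rewrite lt_min !divr_gt0 ?mulr_gt0.
have etaB : eta * cB <= 2^-1 by rewrite -ler_pdivlMr // ge_min lexx.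
have etak : eta * (ck * (cB * (`|v| + 1))) <= kappa / 8.
  by rewrite -ler_pdivlMr ?mulr_gt0 // ge_min lexx orbT.
pose V := [set p' | `|local_rep i p (i p) (coords p p') -
    local_rep i p (i p) (coords p p) - L (coords p p' - coords p p)|
    <= eta * `|coords p p' - coords p p| ] `&` cdom (chart_at p).
have Vp : nbhs p V.
  apply: filterI.
    exact: (cmap_continuous (chart_at_dom p) (diff_first_order di eta0)).
  by apply: open_nbhs_nbhs; split; [exact: cdom_open|exact: chart_at_dom].
(* Embeddedness enters here: points of [S] close to [i p] come from points of [N] close to [p]. *)
have [W oW VW] := emb _ (@open_interior _ V).
have Wp : nbhs (i p) W.
  apply: open_nbhs_nbhs; split => //.
  by have : V^° p by []; rewrite VW.
have [t [P' [t0 SP' WP' tv]]] := cSv e W e0 Wp.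
have [p' _ ip'] : range i P' by rewrite /i sub_range.
have [E cp'] : V p' by apply: interior_subset; rewrite VW /= -/i ip'.
have lE q : cdom (chart_at p) q ->
    local_rep i p (i p) (coords p q) = coords (i p) (i q).
  by move=> qd; rewrite /local_rep /= cmapK.
move: E; rewrite /= !lE //; last exact: chart_at_dom.
rewrite ip'; move: tv.
set D := coords (i p) P' - _; set z := coords p p' - _ => tv E.
have D_le : `|D| <= `|t| * (`|v| + 1).
  rewrite -(subrK (t *: v) D) (le_trans (ler_normD _ _)) // normrZ mulrDr addrC.
  by rewrite lerD2l (le_trans tv) // mulrC ler_wpM2l.
have z_le : `|z| <= 2 * cB * (`|t| * (`|v| + 1)).
  (* The last term has norm at most half that of [z], by the first bound on [eta], and is absorbed
     on the left. *)
  have zE : z = B D - B (D - L z) by rewrite (linearB B D) LB subKr.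
  have : `|z| <= cB * `|D| + cB * (eta * `|z|).
    rewrite [in leLHS]zE (le_trans (ler_normB _ _)) // lerD //.
    by rewrite (le_trans (leB _)) // ler_pM2l.
  have : cB * `|D| <= cB * (`|t| * (`|v| + 1)) by rewrite ler_pM2l.
  have : cB * (eta * `|z|) <= 2^-1 * `|z|.
    by rewrite mulrA [cB * _]mulrC ler_wpM2r.
  lra.
have K_le : `|t| * kappa <= ck * (eta * `|z|) + ck * (e * `|t|).
  rewrite /kappa -normrZ.
  (* The projection sending [w] to [w - L (B w)] kills [L z], so only the two error vectors
     remain. *)
  have -> : t *: (v - L (B v)) = ((D - L z) - L (B (D - L z))) -
      ((D - t *: v) - L (B (D - t *: v))).
    have -> : B (D - L z) = B D - z by rewrite (linearB B D) LB.
    have -> : L (B D - z) = L (B D) - L z by rewrite linearB.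
    have -> : B (D - t *: v) = B D - t *: B v by rewrite (linearB B D) linearZ.
    have -> : L (B D - t *: B v) = L (B D) - t *: L (B v).
      by rewrite (linearB L (B D)) linearZ.
    by apply/rowP => l; rewrite !mxE; ring.
  rewrite (le_trans (ler_normB _ _)) // lerD // (le_trans (leK _)) //.
    by rewrite ler_pM2l.
  by rewrite ler_pM2l.
have nt : 0 < `|t| by rewrite normr_gt0.
suff : `|t| * kappa <= `|t| * (kappa / 2) by rewrite ler_pM2l //; lra.
apply: le_trans K_le _.
have h1 : ck * (eta * `|z|) <= `|t| * (kappa / 4).
  apply: (@le_trans _ _ (ck * (eta * (2 * cB * (`|t| * (`|v| + 1)))))).
    by rewrite ler_pM2l // ler_pM2l.
  have -> : ck * (eta * (2 * cB * (`|t| * (`|v| + 1)))) =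
    `|t| * (2 * (eta * (ck * (cB * (`|v| + 1))))) by ring.
  by rewrite ler_pM2l //; lra.
have h2 : ck * (e * `|t|) <= `|t| * (kappa / 4) by rewrite mulrA mulrC ler_pM2l.
lra.
Qed.

Lemma sub_incl_in M (S : set M) (N : submanifold S) (p : N) : S (sub_incl N p).
Proof.
have h : range (sub_incl N) `<=` S by rewrite (sub_range N).
by apply: h; exists p.
Qed.

Lemma sub_tangentP M (S : set M) (N : submanifold S) (p : N) v :
  (v \in sub_tangent p) <-> exists u, v = tmap (sub_incl N) p u.
Proof.
split; first by move=> /memv_imgP[u _ ->]; exists u; rewrite mdiffE.
by move=> [u ->]; rewrite -mdiffE memv_img ?memvf.
Qed.

Lemma sub_tangent_cst M N (S : set M) (T : submanifold S) (f : M -> N)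
    (p : T) (c : N) v :
  smooth f -> (forall p', S p' -> f p' = c) -> v \in sub_tangent p ->
  tmap f (sub_incl T p) v = 0.
Proof.
move=> sf fc /sub_tangentP[u ->].
have [sT _] := sub_immersion T.
have [_ <-] := tmap_comp (smooth_mdifferentiable p sT)
  (smooth_mdifferentiable (sub_incl T p) sf).
have -> : f \o sub_incl T = fun=> c.
  by apply/funext => p' /=; apply: fc; exact: sub_incl_in.
exact: tmap_cst.
Qed.

Lemma tmap_fst M N (p : prod_manifold M N) :
  @mdifferentiable _ (prod_manifold M N) M fst p /\
  forall u, @tmap _ (prod_manifold M N) M fst p u = lsubmx u.
Proof.
have E : \forall u \near coords p p,
    lsubmx u = @local_rep _ (prod_manifold M N) M fst p p.1 u.
  apply: filterS (chart_nbhs (chart_at_dom p) filterT) => u [_ _ uE].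
  by rewrite -[in LHS]uE /= row_mxKl.
have dl := @differentiable_lsubmx R 1 (mdim M) (mdim N) (coords p p).
have [d dE] := near_eq_diff E dl.
split=> [|u]; first by split => //; exact: cvg_fst.
by rewrite /tmap dE diff_lin //; exact: continuous_lsubmx.
Qed.

Lemma tmap_snd M N (p : prod_manifold M N) :
  @mdifferentiable _ (prod_manifold M N) N snd p /\
  forall u, @tmap _ (prod_manifold M N) N snd p u = rsubmx u.
Proof.
have E : \forall u \near coords p p,
    rsubmx u = @local_rep _ (prod_manifold M N) N snd p p.2 u.
  apply: filterS (chart_nbhs (chart_at_dom p) filterT) => u [_ _ uE].
  by rewrite -[in LHS]uE /= row_mxKr.
have dl := @differentiable_rsubmx R 1 (mdim M) (mdim N) (coords p p).
have [d dE] := near_eq_diff E dl.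
split=> [|u]; first by split => //; exact: cvg_snd.
by rewrite /tmap dE diff_lin //; exact: continuous_rsubmx.
Qed.

(** Charts of the product are pairs of charts, so the local representative is a [row_mx] by
    computation. *)
Lemma tmap_pair M N P (f : M -> N) (g : M -> P) (p : M) v :
  mdifferentiable f p -> mdifferentiable g p ->
  @tmap _ M (prod_manifold N P) (fun p => (f p, g p)) p v =
  row_mx (tmap f p v) (tmap g p v).
Proof.
move=> [_ df] [_ dg].
have [d E] := differentiable_row_mx df dg.
apply: etrans (esym (deriveE v d)) _.
by rewrite E (deriveE v df) (deriveE v dg).
Qed.

Lemma normal_classP M (S : set M) (N : submanifold S) (p : N)
    (v w : tangent (sub_incl N p)) :
  (normal_class v = normal_class w) <-> (v - w \in sub_tangent p).
Proof.
rewrite /normal_class; split.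
  by move/eqP; rewrite -Quotient.idealrBE.
by move=> H; apply/eqP; rewrite -Quotient.idealrBE.
Qed.
End Tangent.

(** * Tangent vectors to composable pairs and the differential of the multiplication *)

Section Composition.
Variable R : realType.

Lemma norm_lsubmx_le m n (u : 'rV[R]_(m + n)) : `|lsubmx u| <= `|u|.
Proof. by apply: norm_le_coord => // i j; rewrite mxE le_coord_norm. Qed.

Lemma norm_rsubmx_le m n (u : 'rV[R]_(m + n)) : `|rsubmx u| <= `|u|.
Proof. by apply: norm_le_coord => // i j; rewrite mxE le_coord_norm. Qed.

Lemma strict_diff_sub_prod m n k (f Lf : 'rV[R]_m -> 'rV[R]_k)
    (g Lg : 'rV[R]_n -> 'rV[R]_k) (u : 'rV[R]_(m + n)) :
  strict_diff f (lsubmx u) Lf -> strict_diff g (rsubmx u) Lg ->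
  strict_diff (fun w => f (lsubmx w) - g (rsubmx w)) u
    (fun w => Lf (lsubmx w) - Lg (rsubmx w)).
Proof.
move=> sf sg e e0; have e2 : 0 < e / 2 by rewrite divr_gt0.
have [d d0 dP] := sf _ e2; have [d' d'0 d'P] := sg _ e2.
exists (Num.min d d') => [|w w']; first by rewrite lt_min d0.
rewrite !lt_min => /andP[wd wd'] /andP[w'd w'd'].
have l z r : `|z - u| < r -> `|lsubmx z - lsubmx u| < r.
  by move=> h; rewrite -linearB (le_lt_trans (norm_lsubmx_le _)).
have r z s : `|z - u| < s -> `|rsubmx z - rsubmx u| < s.
  by move=> h; rewrite -linearB (le_lt_trans (norm_rsubmx_le _)).
have := dP _ _ (l _ _ wd) (l _ _ w'd); have := d'P _ _ (r _ _ wd') (r _ _ w'd').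
have := norm_lsubmx_le (w - w'); have := norm_rsubmx_le (w - w').
rewrite -!linearB; set a := Lf _; set b := Lg _ => nr nl hg hf.
set x := (X in `|X| <= _).
have -> : x = (f (lsubmx w) - f (lsubmx w') - a) -
    (g (rsubmx w) - g (rsubmx w') - b).
  by rewrite /x; apply/rowP => i; rewrite !mxE; ring.
apply: le_trans (ler_normB _ _) _.
rewrite [leRHS](_ : _ = e / 2 * `|w - w'| + e / 2 * `|w - w'|); last by field.
apply: lerD; [apply: le_trans hf _ | apply: le_trans hg _];
  by rewrite ler_pM2l.
Qed.

Variable G : lie_groupoid R.

(** Near the given pair, composability is the vanishing of [F], the difference of source and target
    in one chart; its differential is onto because the source map is a submersion. *)
Lemma composable_tangent (c : composable G) (xi zeta : 'rV[R]_(mdim (ar G))) :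
  let gh := sub_incl (composable G) c in
  tmap gsrc gh.1 xi = tmap gtgt gh.2 zeta -> row_mx xi zeta \in sub_tangent c.
Proof.
move=> gh E; apply: tangent_cone_sub_tangent; first exact: composable_embedded.
have gh_comp : gsrc gh.1 = gtgt gh.2 := sub_incl_in c.
have [ss es] := gsrc_submersion G; have [st et] := gtgt_submersion G.
pose q := chart_at (gsrc gh.1).
have q1 : cdom q (gsrc gh.1) by exact: chart_at_dom.
have q2 : cdom q (gtgt gh.2) by rewrite -gh_comp.
have [_ sds] := smooth_strict_diff ss q1.
have [_ sdt] := smooth_strict_diff st q2.
(* The target of [gh.2] is the source of [gh.1], so [q] is also the chart used by
   [tmap gtgt gh.2]. *)
have LtE : tmap gtgt gh.2 =
    'd (local_rep gtgt gh.2 (gsrc gh.1)) (coords gh.2 gh.2).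
  by rewrite gh_comp.
rewrite -LtE in sdt; rewrite -/(tmap gsrc gh.1) in sds.
have Ls_surj w := submersion_surj gh.1 w (gsrc_submersion G).
move: E Ls_surj sds sdt {LtE}; move: (tmap gsrc gh.1) (tmap gtgt gh.2).
move=> Ls Lt E Ls_surj sds sdt.
pose L : {linear 'rV[R]_(mdim (ar G) + mdim (ar G)) -> 'rV[R]_(mdim (ob G))} :=
  (Ls \o lsubmx) \- (Lt \o rsubmx).
have LE u1 u2 : L (row_mx u1 u2) = Ls u1 - Lt u2.
  rewrite -[L _]/(Ls (lsubmx (row_mx u1 u2)) - Lt (rsubmx (row_mx u1 u2))).
  by rewrite row_mxKl row_mxKr.
pose F (p : prod_manifold (ar G) (ar G)) :=
  cmap q (gsrc p.1) - cmap q (gtgt p.2).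
apply: (@tangent_cone_level R (prod_manifold (ar G) (ar G)) gh _
  [set p | cdom q (gsrc p.1) /\ cdom q (gtgt p.2)] _ F L).
- rewrite -(row_mxKl (coords gh.1 gh.1) (coords gh.2 gh.2)) in sds.
  rewrite -(row_mxKr (coords gh.1 gh.1) (coords gh.2 gh.2)) in sdt.
  exact: strict_diff_sub_prod sds sdt.
- move=> w; have [u <-] := Ls_surj w.
  by exists (row_mx u 0); rewrite LE linear0 subr0.
- by rewrite LE E subrr.
- apply: filterI.
    have : {for gh, continuous (gsrc \o fst : ar G * ar G -> ob G)}.
      by apply: continuous_comp; [exact: cvg_fst|exact: ss.1].
    by apply; apply: open_nbhs_nbhs; split => //; exact: cdom_open.
  have : {for gh, continuous (gtgt \o snd : ar G * ar G -> ob G)}.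
    by apply: continuous_comp; [exact: cvg_snd|exact: st.1].
  by apply; apply: open_nbhs_nbhs; split => //; exact: cdom_open.
- move=> p [p1 p2]; rewrite /F gh_comp subrr => /eqP.
  rewrite subr_eq0 => /eqP Ep.
  by rewrite /= -(cmapK p1) Ep cmapK.
Qed.

(** [theta] is the image of the pair [xi], [zeta] under the differential of the multiplication; the
    equations differentiate [gsrc_mul] and [gtgt_mul]. *)
Lemma tangent_gmul (g h : ar G) (xi zeta : 'rV[R]_(mdim (ar G))) :
  gsrc g = gtgt h -> tmap gsrc g xi = tmap gtgt h zeta ->
  exists theta, tmap gsrc (gmul g h) theta = tmap gsrc h zeta /\
    tmap gtgt (gmul g h) theta = tmap gtgt g xi.
Proof.
move=> gh E; set C := composable G.
have [c _ cE] : range (sub_incl C) (g, h) by rewrite sub_range.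
have [E1 E2] : g = (sub_incl C c).1 /\ h = (sub_incl C c).2 by rewrite cE.
have : row_mx xi zeta \in sub_tangent c.
  by apply: composable_tangent; rewrite -E1 -E2.
move=> /sub_tangentP[chi chiE].
have ss := (gsrc_submersion G).1; have st := (gtgt_submersion G).1.
have si := (sub_immersion C).1.
have di := smooth_mdifferentiable c si.
pose m (c : C) := gmul (sub_incl C c).1 (sub_incl C c).2.
have dm : mdifferentiable m c := smooth_mdifferentiable c (@gmul_smooth _ G).
have mE : m c = gmul g h by rewrite /m cE.
have comp c' : gsrc (sub_incl C c').1 = gtgt (sub_incl C c').2.
  exact: (sub_incl_in c').
have [df tf] := tmap_fst (sub_incl C c).
have [ds ts] := tmap_snd (sub_incl C c).
have smE : gsrc \o m = gsrc \o (snd \o sub_incl C).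
  by apply/funext => c' /=; rewrite gsrc_mul.
have tmE : gtgt \o m = gtgt \o (fst \o sub_incl C).
  by apply/funext => c' /=; rewrite gtgt_mul.
have [d1 t1] := tmap_comp di df; have [d2 t2] := tmap_comp di ds.
have msE := (tmap_comp dm (smooth_mdifferentiable (m c) ss)).2 chi.
have mtE := (tmap_comp dm (smooth_mdifferentiable (m c) st)).2 chi.
have psE := (tmap_comp d2 (smooth_mdifferentiable _ ss)).2 chi.
have ptE := (tmap_comp d1 (smooth_mdifferentiable _ st)).2 chi.
have a1 : tmap (fst \o sub_incl C) c chi = xi.
  by rewrite t1 tf -chiE row_mxKl.
have a2 : tmap (snd \o sub_incl C) c chi = zeta.
  by rewrite t2 ts -chiE row_mxKr.
rewrite a1 in ptE; rewrite a2 in psE.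
exists (tmap m c chi); rewrite -mE; split.
  apply: (etrans (esym msE)).
  rewrite smE.
  apply: (etrans psE).
  rewrite E2; reflexivity.
apply: (etrans (esym mtE)); rewrite tmE; apply: (etrans ptE).
rewrite E1; reflexivity.
Qed.
End Composition.

(** * Tangent spaces of the source fibre, of the orbit and of the arrows with given ends *)

Section OrbitTangent.
Variables (R : realType) (G : lie_groupoid R) (x : ob G).
Variables (F : submanifold (gsrc_fibre x)) (eF : embedded F).

(** The source map is constant on its fibre; conversely its kernel consists of limiting directions
    of the fibre, which is embedded. *)
Lemma gsrc_fibre_tangentP (h : F) (zeta : 'rV[R]_(mdim (ar G))) :
  (zeta \in sub_tangent h) <-> tmap gsrc (sub_incl F h) zeta = 0.
Proof.
have ss := gsrc_submersion G; split.
  by apply: (@sub_tangent_cst _ _ _ _ _ _ _ x) => //; exact: ss.1.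
move=> z0; apply: tangent_cone_sub_tangent => //.
have := tangent_cone_fibre ss z0.
by rewrite (sub_incl_in h : gsrc (sub_incl F h) = x).
Qed.

Variables (O : submanifold (lg_orbit x)) (q : F -> O).
Hypotheses (sq : submersion q)
  (hq : forall h, sub_incl O (q h) = gtgt (sub_incl F h)).

Lemma tmap_orbit (h : F) (u : 'rV[R]_(mdim F)) :
  tmap (sub_incl O) (q h) (tmap q h u) =
  tmap gtgt (sub_incl F h) (tmap (sub_incl F) h u).
Proof.
have dq := smooth_mdifferentiable h sq.1.
have dO := smooth_mdifferentiable (q h) (sub_immersion O).1.
have dF := smooth_mdifferentiable h (sub_immersion F).1.
have dt := smooth_mdifferentiable (sub_incl F h) (gtgt_submersion G).1.
apply: (etrans (esym ((tmap_comp dq dO).2 u))).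
apply: etrans ((tmap_comp dF dt).2 u).
have -> // : sub_incl O \o q = gtgt \o sub_incl F.
by apply/funext => h' /=; exact: hq.
Qed.

(** As [q] is a submersion, tangent vectors of the orbit lift to the source fibre. *)
Lemma orbit_tangentP (h : F) (v : 'rV[R]_(mdim (ob G))) :
  (v \in sub_tangent (q h)) <-> exists zeta,
    tmap gsrc (sub_incl F h) zeta = 0 /\ tmap gtgt (sub_incl F h) zeta = v.
Proof.
split; last first.
  move=> [zeta []] /gsrc_fibre_tangentP/sub_tangentP[u ->] <-.
  by apply/sub_tangentP; exists (tmap q h u); rewrite tmap_orbit.
move=> /sub_tangentP[w ->]; have [u <-] := submersion_surj h w sq.
exists (tmap (sub_incl F) h u); rewrite tmap_orbit; split => //.
by apply/gsrc_fibre_tangentP/sub_tangentP; exists u.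
Qed.

(** This makes the normal representation well defined. A vector tangent to the orbit at [x] is the
    target image of some [zeta] at the unit killed by the source; multiplying by the unit turns
    [eta] and [zeta] into a vector at the same arrow, killed by the source, with the target image of
    [eta]. *)
Lemma gtgt_sub_tangent (h0 h : F) (eta : 'rV[R]_(mdim (ar G))) :
  sub_incl F h0 = gunit x ->
  tmap gsrc (sub_incl F h) eta \in sub_tangent (q h0) ->
  tmap gtgt (sub_incl F h) eta \in sub_tangent (q h).
Proof.
move=> h0E /orbit_tangentP[zeta]; rewrite h0E => -[z0 zE].
have sg : gsrc (sub_incl F h) = x := sub_incl_in h.
have g1 : gsrc (sub_incl F h) = gtgt (gunit x) by rewrite gtgt_unit.
have [theta [th0 thE]] := tangent_gmul g1 (esym zE).
have gE : gmul (sub_incl F h) (gunit x) = sub_incl F h.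
  by have := gmul_unitr (sub_incl F h); rewrite sg.
rewrite gE in th0 thE; apply/orbit_tangentP; exists theta.
by split; [exact: (etrans th0 z0)|exact: thE].
Qed.

(** A vector killed by both differentials comes from some [u] tangent to the source fibre. The orbit
    being immersed, [q] kills [u], which is thus a limiting direction of a fibre of [q]; the
    inclusion carries that fibre into [arrows y x]. *)
Lemma arrows_tangentP y (Gyx : submanifold (arrows y x)) (k : Gyx) (h : F)
    (g : ar G) (xi : 'rV[R]_(mdim (ar G))) :
  embedded Gyx -> sub_incl Gyx k = g -> sub_incl F h = g ->
  (xi \in sub_tangent k) <-> tmap gsrc g xi = 0 /\ tmap gtgt g xi = 0.
Proof.
move=> eG <- hk; split=> [xik|].
  split.
    by apply: (@sub_tangent_cst _ _ _ _ _ _ _ x) => // [|p [] //];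
      exact: (gsrc_submersion G).1.
  by apply: (@sub_tangent_cst _ _ _ _ _ _ _ y) => // [|p [] //];
    exact: (gtgt_submersion G).1.
move=> H; apply: tangent_cone_sub_tangent => //; move: H; rewrite -hk.
move=> [] /gsrc_fibre_tangentP/sub_tangentP[u ->]; rewrite -tmap_orbit => qu0.
have {}qu0 : tmap q h u = 0.
  have : tmap q h u \in lker (mdiff (sub_incl O) (q h)).
    by rewrite memv_ker mdiffE qu0.
  by rewrite (sub_immersion O).2 memv0 => /eqP.
apply: tangent_cone_image (tangent_cone_fibre sq qu0).
  exact: smooth_mdifferentiable h (sub_immersion F).1.
move=> h' /= qh'; split; first exact: (sub_incl_in h').
by rewrite -hq qh' hq hk; exact: (sub_incl_in k).2.
Qed.

End OrbitTangent.

(** * Kernel and image of the differential of the anchor *)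

Theorem proposition3p5p1 (R : realType) (G : lie_groupoid R)
    (x y : ob G) (g : ar G) (hs : gsrc g = x) (ht : gtgt g = y)
    (* the embedded submanifold G(y,x), and g as a point of it *)
    (Gyx : submanifold (arrows y x)) (hGyx : embedded Gyx)
    (k : Gyx) (hk : sub_incl Gyx k = g)
    (* the orbit of x with its smooth structure, and x, y as points of it *)
    (O : submanifold (lg_orbit x)) (hO : orbit_structure O)
    (a b : O) (ha : sub_incl O a = x) (hb : sub_incl O b = y) :
  lker (mdiff anchor g) = sub_tangent k /\
  forall (v : tangent y) (w : tangent x),
    (row_mx v w \in limg (mdiff anchor g)) <->
    normal_class (v : tangent (sub_incl O b)) =
      normal_rep a b g (normal_class (w : tangent (sub_incl O a))).
Proof.
have [F [eF [q sq hq]]] := hO.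
have anchorE (xi : 'rV[R]_(mdim (ar G))) :
    tmap anchor g xi = row_mx (tmap gtgt g xi) (tmap gsrc g xi).
  by apply: tmap_pair; apply: smooth_mdifferentiable;
    [exact: (gtgt_submersion G).1 | exact: (gsrc_submersion G).1].
have [h _ hg] : range (sub_incl F) g by rewrite sub_range.
have [h0 _ h0E] : range (sub_incl F) (gunit x).
  by rewrite sub_range; exact: gsrc_unit.
(* The inclusion of the orbit is injective, so [a] and [b] are the projections of the unit at [x]
   and of [g]. *)
have ah0 : a = q h0 by apply: (@sub_inj _ _ _ O); rewrite hq h0E gtgt_unit.
have bh : b = q h by apply: (@sub_inj _ _ _ O); rewrite hq hg ht.
subst a b; split.
  apply/vspaceP => xi; rewrite memv_ker mdiffE anchorE.
  have kP := arrows_tangentP eF sq hq xi hGyx hk hg.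
  apply/eqP/idP => [E0|].
    apply/kP.
    have [t0 s0] := eq_row_mx
      (etrans E0 (esym (row_mx0 R 1 (mdim (ob G)) (mdim (ob G))))).
    exact: conj s0 t0.
  move=> /kP [s0 t0]; apply: etrans (congr2 _ t0 s0) _; exact: row_mx0.
move=> v w.
(* Any lift [xi] of [w] computes the normal representation: two lifts give the same class, and [xi]
   itself rules out the default value of [xget]. *)
have repE (xi : 'rV[R]_(mdim (ar G))) : tmap gsrc g xi = w ->
    normal_rep (q h0) (q h) g (normal_class (w : tangent (sub_incl O (q h0)))) =
    normal_class (tmap gtgt g xi : tangent (sub_incl O (q h))).
  move=> xiw; rewrite /normal_rep.
  case: xgetP => [c' -> [w' [xi' [ww' xi'w' <-]]]|].
    rewrite mdiffE; apply/normal_classP.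
    move: xi'w' ww'; rewrite mdiffE => <- /normal_classP; rewrite -xiw.
    move=> H.
    have sB : tmap gsrc g xi' - tmap gsrc g xi = tmap gsrc g (xi' - xi).
      by rewrite linearB.
    have tB : tmap gtgt g xi' - tmap gtgt g xi = tmap gtgt g (xi' - xi).
      by rewrite linearB.
    have H' := eq_ind _
      (fun z : 'rV[R]_(mdim (ob G)) => z \in sub_tangent (q h0)) H _ sB.
    have := gtgt_sub_tangent eF sq hq (h := h) (eta := xi' - xi) h0E.
    rewrite hg => /(_ H') H''.
    exact: (eq_ind _
      (fun z : 'rV[R]_(mdim (ob G)) => z \in sub_tangent (q h)) H'' _ (esym tB)).
  move=> /(_ (normal_class (tmap gtgt g xi : tangent (sub_incl O (q h))))) [].
  exists w, xi; split; first by [].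
    exact: (etrans (mdiffE gsrc xi) xiw).
  exact: (congr1 (@normal_class _ _ _ O (q h)) (mdiffE gtgt xi)).
split.
  move=> /memv_imgP[xi _ E].
  have [vE wE] := eq_row_mx (etrans E (etrans (mdiffE anchor xi) (anchorE xi))).
  by rewrite (repE xi (esym wE)) vE.
(* Conversely, [v] differs from the target image of a lift [xi] of [w] by that of some [zeta] killed
   by the source; then [xi + zeta] is a preimage. *)
have [xi xiw] := submersion_surj g w (gsrc_submersion G).
rewrite (repE xi) // => /normal_classP.
move=> /(orbit_tangentP eF sq hq)[zeta]; rewrite hg => -[z0 zE].
have vE : tmap gtgt g (xi + zeta) = v by rewrite linearD /= zE addrC subrK.
have wE : tmap gsrc g (xi + zeta) = w by rewrite linearD /= z0 addr0.
have -> : row_mx v w = mdiff anchor g (xi + zeta).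
  apply: esym; apply: etrans (mdiffE anchor _) _.
  exact: (etrans (anchorE _) (congr2 (@row_mx R 1 _ _) vE wE)).
by rewrite memv_img ?memvf.
Qed.
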